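(* Consider the capacitated single-item lot-sizing problem $(L)$ with $\underline{\alpha_t}=\underline{\beta_t}=0$ for all $t\in\{1,\dots,T\}$. Let $S$ be any set of (pairwise) disjoint sub-problems of $(L)$ and, for each sub-problem $i=(L_{u_i,v_i})\in S$, let $w_i$ be a lower bound of its total cost $C^{u_iv_i}$, i.e. $w_i$ is at most the total cost of every feasible solution of $(L_{u_i,v_i})$. Then $$\sum_{i\in S} w_i\leq C,$$ where $C$ is the total cost of $(L)$; that is, the inequality holds for the total cost $C$ of every feasible solution of $(L)$.
   Context: Problem $(L)$. Data: a number of periods $T\in\mathbb{N}$ and, for each $t\in\{1,\dots,T\}$, non-negative integers $p_t$ (unit production cost), $h_t$ (unit holding cost), $s_t$ (setup cost), $d_t$ (demand), minimal and maximal production quantities $\underline{\alpha_t},\overline{\alpha_t}$, minimal and maximal ending inventories $\underline{\beta_t},\overline{\beta_t}$. A feasible solution consists of non-negative integers $X_t$ (production), $I_t$ (inventory at the end of period $t$) and $Y_t\in\{0,1\}$ (setup), for $t=1,\dots,T$, such that, for all $t$, $$I_{t-1}+X_t=d_t+I_t,\qquad X_t\le \overline{\alpha_t}\,Y_t,\qquad \underline{\alpha_t}\le X_t\le\overline{\alpha_t},\qquad \underline{\beta_t}\le I_t\le\overline{\beta_t},$$ with the conventions $I_0=0$ and $I_T=0$. Its total cost is $C=\sum_{t=1}^T p_tX_t+\sum_{t=1}^T h_tI_t+\sum_{t=1}^T s_tY_t$, which is to be minimized. Sub-problems. For $1\le u<v\le T$, the sub-problem $(L_{u,v})$ is defined exactly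 as $(L)$ (same horizon $1,\dots,T$, same production and holding costs, same capacities) except that $d_t=0$ and $s_t=0$ for every $t\notin\{u,u+1,\dots,v\}$. Its total cost is denoted $C^{uv}$. Two sub-problems $(L_{u,v})$ and $(L_{u',v'})$ are disjoint if $\{u,\dots,v\}\cap\{u',\dots,v'\}=\emptyset$. *)

(* Defs.v *)
(* MathComp. *)
From mathcomp Require Import all_boot all_order all_algebra.

Set Implicit Arguments.
Unset Strict Implicit.
Unset Printing Implicit Defensive.

Import Order.TTheory GRing.Theory Num.Theory.

(* Periods are the naturals 1, ..., horizon; the values of the data outside
   this range are never used. *)
Record lot_sizing := LotSizing {
  horizon : nat;
  prod_cost : nat -> nat;
  hold_cost : nat -> nat;
  setup_cost : nat -> nat;
  demand : nat -> nat;
  prod_min : nat -> nat;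
  prod_max : nat -> nat;
  inv_min : nat -> nat;
  inv_max : nat -> nat }.

(* [inventory x t] is the stock at the end of period t, so [inventory x 0] is
   the initial stock. *)
Record plan := Plan {
  production : nat -> nat;
  inventory : nat -> nat;
  setup : nat -> bool }.

Definition feasible (L : lot_sizing) (x : plan) : Prop :=
  [/\ inventory x 0 = 0,
      inventory x (horizon L) = 0 &
      forall t : nat, 1 <= t <= horizon L ->
        [/\ inventory x t.-1 + production x t = demand L t + inventory x t,
            production x t <= prod_max L t * setup x t,
            prod_min L t <= production x t <= prod_max L t &
            inv_min L t <= inventory x t <= inv_max L t]].

Definition total_cost (L : lot_sizing) (x : plan) : nat :=
  \sum_(1 <= t < (horizon L).+1) prod_cost L t * production x t
  + \sum_(1 <= t < (horizon L).+1) hold_cost L t * inventory x t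
  + \sum_(1 <= t < (horizon L).+1) setup_cost L t * setup x t.

Definition subproblem (L : lot_sizing) (u v : nat) : lot_sizing :=
  {| horizon := horizon L;
     prod_cost := prod_cost L;
     hold_cost := hold_cost L;
     setup_cost := fun t => if u <= t <= v then setup_cost L t else 0;
     demand := fun t => if u <= t <= v then demand L t else 0;
     prod_min := prod_min L;
     prod_max := prod_max L;
     inv_min := inv_min L;
     inv_max := inv_max L |}.

(* The sub-problem on {u, ..., v} is named by the pair (u, v), not by the
   instance it produces: distinct pairs may produce the same data. *)
Definition is_subproblem_index (L : lot_sizing)
    (i : 'I_(horizon L).+1 * 'I_(horizon L).+1) : bool :=
  (1 <= i.1) && (i.1 < i.2).

Definition window (L : lot_sizing)
    (i : 'I_(horizon L).+1 * 'I_(horizon L).+1) : {set 'I_(horizon L).+1} :=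
  [set t : 'I_(horizon L).+1 | i.1 <= t <= i.2].

Definition is_lower_bound (R : realDomainType) (L : lot_sizing) (w : R) : Prop :=
  forall x : plan, feasible L x -> (w <= (total_cost L x)%:R)%R.

(* Main.v *)
Require Import Defs.
From mathcomp Require Import all_boot all_order all_algebra.
From mathcomp Require Import zify.

(** A feasible plan of the whole problem splits into feasible plans of the
    sub-problems whose costs add up to at most its own cost.

    Number the units of product 0, 1, 2, ... in the order in which they are
    made, and serve the demand first in, first out.  With [A t] and [D t] the
    cumulated production and demand, the units made in period [t] are those in
    the interval from [A t.-1] to [A t], the units in stock at the end of [t]
    are those from [D t] to [A t], and the units that serve the demand of the
    periods u, ..., v are those from [D u.-1] to [D v].  Keeping only the latter
    units turns the given plan into a plan of the sub-problem on {u, ..., v}: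
    the balance equations say that intervals of units concatenate, and the
    capacities still hold because quantities only decrease and the lower bounds
    are zero ([restrict_feasible]).

    Disjoint windows own disjoint intervals of units, so that the restricted
    productions, and the restricted inventories, add up to at most the original
    ones; each setup cost is charged to at most one window
    ([sum_restrict_cost]).  Hence the costs of the restricted plans, each of
    them at least the given lower bound, sum to at most the total cost. *)

Set Implicit Arguments.
Unset Strict Implicit.
Unset Printing Implicit Defensive.

Lemma sum_exclusive_le1 (I : finType) (S : {set I}) (P : pred I) :
  (forall i j, i \in S -> j \in S -> P i -> P j -> i = j) ->
  \sum_(i in S) P i <= 1.
Proof.
move=> exclP; have [i /andP[Si Pi]|noP] := pickP [pred i in S | P i].
  rewrite (bigD1 i) //= Pi big1 // => j /andP[Sj ji].
  by case Pj: (P j) => //; rewrite (exclP j i) ?eqxx in ji.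
by rewrite big1 // => i Si; have := noP i; rewrite /= Si /= => ->.
Qed.

Definition overlap (a b m n : nat) : nat := \sum_(m <= k < n) (a <= k < b).

Lemma overlap_cat a b m n p :
  m <= n -> n <= p -> overlap a b m p = overlap a b m n + overlap a b n p.
Proof. exact: big_cat_nat. Qed.

Lemma overlap_le a b m n : overlap a b m n <= n - m.
Proof.
rewrite -[n - m]muln1 -sum_nat_const_nat.
by apply: leq_sum => k _; apply: leq_b1.
Qed.

Lemma overlap_inside a b m n : a <= m -> n <= b -> overlap a b m n = n - m.
Proof.
move=> am nb; rewrite -[RHS]muln1 -sum_nat_const_nat.
by apply: eq_big_nat => k /andP[mk kn]; rewrite (leq_trans am) ?(leq_trans kn).
Qed.

Lemma overlap_outside a b m n : (n <= a) || (b <= m) -> overlap a b m n = 0.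
Proof.
move=> out; rewrite /overlap big_nat big1 // => k /andP[mk kn]; lia.
Qed.

Lemma sum_overlap_le (I : finType) (S : {set I}) (a b : I -> nat) m n :
  (forall i j k, i \in S -> j \in S -> a i <= k < b i -> a j <= k < b j ->
     i = j) ->
  \sum_(i in S) overlap (a i) (b i) m n <= n - m.
Proof.
move=> disj; rewrite exchange_big /= -[n - m]muln1 -sum_nat_const_nat.
by apply: leq_sum => k _; apply: sum_exclusive_le1 => i j Si Sj; apply: disj.
Qed.

Definition cumul (f : nat -> nat) (t : nat) : nat := \sum_(1 <= r < t.+1) f r.

Lemma cumul0 f : cumul f 0 = 0.
Proof. by rewrite /cumul big_nil. Qed.

Lemma cumulS f t : cumul f t.+1 = cumul f t + f t.+1.
Proof. by rewrite /cumul big_nat_recr. Qed.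

Lemma cumul_le f s t : s <= t -> cumul f s <= cumul f t.
Proof.
move=> /subnKC <-; elim: (t - s) => [|n IHn]; first by rewrite addn0.
by rewrite addnS cumulS (leq_trans IHn) ?leq_addr.
Qed.

Lemma cumul_balance L x t : feasible L x -> t <= horizon L ->
  cumul (production x) t = cumul (demand L) t + inventory x t.
Proof.
move=> [I0 _ feas]; elim: t => [_|t IHt tT]; first by rewrite !cumul0 I0.
have [/= bal _ _ _] := feas t.+1 tT.
rewrite !cumulS (IHt (ltnW tT)); lia.
Qed.

(** The part of a plan that serves the window.  All setups are kept: those
    before the window may be needed to produce for it in advance, and those
    outside the window are free in the sub-problem. *)
Definition restrict (L : lot_sizing) (x : plan) (u v : nat) : plan :=
  let own := overlap (cumul (demand L) u.-1) (cumul (demand L) v) in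
  {| production := fun t =>
       own (cumul (production x) t.-1) (cumul (production x) t);
     inventory := fun t => own (cumul (demand L) t) (cumul (production x) t);
     setup := setup x |}.

(** First-in-first-out service respects the windows: a unit that serves period
    [t] is owned by the window exactly when [t] belongs to it. *)
Lemma overlap_demand L u v t : 0 < u -> 0 < t ->
  overlap (cumul (demand L) u.-1) (cumul (demand L) v)
          (cumul (demand L) t.-1) (cumul (demand L) t)
  = demand (subproblem L u v) t.
Proof.
case: u t => [//|u] [//|t] _ _ /=; case: ifP => [/andP[ut tv]|out].
  by rewrite overlap_inside ?cumul_le // cumulS addKn.
apply: overlap_outside; case: (leqP u.+1 t.+1) => ut; last first.
  by rewrite cumul_le.
by rewrite [X in _ || X]cumul_le ?orbT //; lia.
Qed.

Lemma restrict_production_le L x u v t : 0 < t ->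
  production (restrict L x u v) t <= production x t.
Proof.
case: t => [//|t] _ /=; apply: leq_trans (overlap_le _ _ _ _) _.
by rewrite cumulS addKn.
Qed.

Lemma restrict_inventory_le L x u v t : feasible L x -> t <= horizon L ->
  inventory (restrict L x u v) t <= inventory x t.
Proof.
move=> feas tT /=; apply: leq_trans (overlap_le _ _ _ _) _.
by rewrite (cumul_balance feas tT) addKn.
Qed.

Lemma restrict_feasible L x u v :
  (forall t, 1 <= t <= horizon L -> prod_min L t = 0) ->
  (forall t, 1 <= t <= horizon L -> inv_min L t = 0) ->
  0 < u -> feasible L x -> feasible (subproblem L u v) (restrict L x u v).
Proof.
move=> pmin0 imin0 u0 feas; have [_ IT periods] := feas; split.
- by rewrite /= !cumul0 overlap_outside.
- apply/eqP; rewrite -leqn0 -[X in _ <= X]IT.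
  exact: restrict_inventory_le.
move=> t tT; have /andP[t0 tleT] := tT.
have [_ Xsetup /andP[_ Xmax] /andP[_ Imax]] := periods t tT.
have Xle := restrict_production_le L x u v t0.
have Ile := restrict_inventory_le u v feas tleT.
split; last 3 first.
- exact: leq_trans Xle Xsetup.
- by rewrite /= pmin0 //=; apply: leq_trans Xle Xmax.
- by rewrite /= imin0 //=; apply: leq_trans Ile Imax.
(* Both sides count the owned units between [D t.-1] and [A t]: the left one
   cuts that interval at [A t.-1], the right one at [D t]. *)
have DA s : s <= horizon L -> cumul (demand L) s <= cumul (production x) s.
  by move=> sT; rewrite (cumul_balance feas sT) leq_addr.
rewrite -overlap_demand // -!overlap_cat ?cumul_le ?leq_pred ?DA //.
by rewrite (leq_trans (leq_pred t)).
Qed.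

(** For production and inventory, no unit is counted twice: cumulated demand is
    nondecreasing, so ordered windows own ordered, hence disjoint, intervals of
    units.  For setups, no period is charged twice: a sub-problem only pays for
    the periods of its own window. *)
Lemma sum_restrict_cost L x (I : finType) (S : {set I}) (u v : I -> nat) :
  feasible L x ->
  (forall i j, i \in S -> j \in S -> i != j -> (v i < u j) || (v j < u i)) ->
  \sum_(i in S)
     total_cost (subproblem L (u i) (v i)) (restrict L x (u i) (v i))
  <= total_cost L x.
Proof.
move=> feas ordered.
have units_disj i j k : i \in S -> j \in S ->
    cumul (demand L) (u i).-1 <= k < cumul (demand L) (v i) ->
    cumul (demand L) (u j).-1 <= k < cumul (demand L) (v j) -> i = j.
  move=> Si Sj ki kj; apply/eqP/negPn/negP => /(ordered i j Si Sj) /orP[] vu.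
    have : cumul (demand L) (v i) <= cumul (demand L) (u j).-1.
      by apply: cumul_le; lia.
    lia.
  have : cumul (demand L) (v j) <= cumul (demand L) (u i).-1.
    by apply: cumul_le; lia.
  lia.
rewrite /total_cost !big_split /=.
rewrite ![\sum_(i in S) \sum_(1 <= t < _) _]exchange_big /=.
apply: leq_add; first apply: leq_add.
- rewrite big_nat [leqRHS]big_nat; apply: leq_sum => t /andP[t0 _].
  rewrite -big_distrr leq_mul2l /= (leq_trans (sum_overlap_le _ _ units_disj)) ?orbT //.
  by case: t t0 => // t _; rewrite cumulS addKn.
- rewrite big_nat [leqRHS]big_nat; apply: leq_sum => t /andP[_ tT].
  rewrite -big_distrr leq_mul2l /= (leq_trans (sum_overlap_le _ _ units_disj)) ?orbT //.
  by rewrite (cumul_balance feas tT) addKn.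
- apply: leq_sum => t _.
  rewrite (eq_bigr (fun i => (u i <= t <= v i) * (setup_cost L t * setup x t)));
    last by move=> i _; case: ifP; rewrite ?mul1n.
  rewrite -big_distrl -[leqRHS]mul1n leq_mul2r /= sum_exclusive_le1 ?orbT //.
  move=> i j Si Sj ti tj; apply/eqP/negPn/negP => /(ordered i j Si Sj); lia.
Qed.

Lemma disjoint_windows_ordered L (i j : 'I_(horizon L).+1 * 'I_(horizon L).+1) :
  is_subproblem_index i -> is_subproblem_index j ->
  [disjoint window i & window j] -> (i.2 < j.1) || (j.2 < i.1).
Proof.
move=> /andP[_ iuv] /andP[_ juv] /pred0P dis; apply/negPn/negP => overl.
(* Otherwise the later of the two first periods lies in both windows. *)
have [ij|ji] := leqP i.1 j.1.
  have := dis j.1; rewrite /= !inE; lia.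
have := dis i.1; rewrite /= !inE; lia.
Qed.

Theorem theorem1 (R : realDomainType) (L : lot_sizing)
    (hprod : forall t : nat, 1 <= t <= horizon L -> prod_min L t = 0)
    (hinv : forall t : nat, 1 <= t <= horizon L -> inv_min L t = 0)
    (S : {set 'I_(horizon L).+1 * 'I_(horizon L).+1})
    (hS : forall i, i \in S -> is_subproblem_index i)
    (hdisj : forall i j, i \in S -> j \in S -> i != j ->
       [disjoint window i & window j])
    (w : 'I_(horizon L).+1 * 'I_(horizon L).+1 -> R)
    (hw : forall i, i \in S -> is_lower_bound (subproblem L i.1 i.2) (w i))
    (x : plan) (hx : feasible L x) :
  (\sum_(i in S) w i <= (total_cost L x)%:R)%R.
Proof.
have w_le i : i \in S ->
    (w i <= (total_cost (subproblem L i.1 i.2) (restrict L x i.1 i.2))%:R)%R.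
  move=> Si; apply: hw => //; apply: restrict_feasible => //.
  by have /andP[] := hS i Si.
apply: Order.POrderTheory.le_trans (Num.Theory.ler_sum _ w_le) _.
rewrite -GRing.natr_sum Num.Theory.ler_nat.
pose period := 'I_(horizon L).+1.
apply: (sum_restrict_cost (u := fun i : period * period => i.1)
                          (v := fun i : period * period => i.2) hx).
move=> i j Si Sj ij.
by apply: disjoint_windows_ordered; rewrite ?hS ?hdisj.
Qed.
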